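(* Let $\mathcal{E}_{\mathrm P}$ be a discrete exponential family on $\mathbb{R}^k$ with base measure $\nu$, parameter space $\Theta$ and convex support $\mathrm P$ satisfying assumptions (A1)-(A4) of the context, and let $F$ be a proper face of $\mathrm P$. Then the family $\mathcal{E}_F=\{p^F_\theta:\theta\in\Theta\}$ is non-identifiable, and its parameter space is the quotient of $\Theta$ modulo $\mathrm{lin}(N_F)$: for $\theta_1,\theta_2\in\Theta$, the distributions with $\nu_F$-densities $p^F_{\theta_1}$ and $p^F_{\theta_2}$ coincide if and only if $\theta_1-\theta_2\in\mathrm{lin}(N_F)$. Furthermore, for any $\theta\in\Theta$ and any $\zeta\in\mathrm{lin}(N_F)$, $$\mathrm{rank}\big(I_F(\theta+\zeta)\big)=\dim(F),$$ where $I_F$ denotes the Fisher information matrix of $\mathcal{E}_F$.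
   Context: Setting. $\nu$ is a measure on $\mathbb{R}^k$ concentrated on its support $\mathrm{supp}(\nu)=$ closure of $\{x:\nu(\{x\})>0\}$. The convex support $\mathrm P$ is the closure of the convex hull of $\mathrm{supp}(\nu)$. The family $\mathcal{E}_{\mathrm P}$ has densities with respect to $\nu$ given by $p_\theta(x)=\exp\{\langle x,\theta\rangle-\psi(\theta)\}$, $\psi(\theta)=\log\int e^{\langle x,\theta\rangle}d\nu(x)$, $\theta\in\Theta$, where $\emptyset\ne\Theta\subseteq\{\theta\in\mathbb{R}^k:\int e^{\langle x,\theta\rangle}d\nu(x)<\infty\}$. Assumptions. (A1) $\mathrm{supp}(\nu)$ is countable. (A2) $\mathrm P$ is a full-dimensional polyhedron in $\mathbb{R}^k$. (A3) Every (nonempty) face $F$ of $\mathrm P$ satisfies $F=\mathrm{convhull}(S_F)$ for some set $S_F$ of points $x$ with $\nu(\{x\})>0$. (A4) $\Theta$ is open. For a face $F$, $\nu_F$ is the restriction of $\nu$ to $F$, and $\mathcal{E}_F$ has densities with respect to $\nu_F$ given by $p^F_\theta(x)=\exp\{\langle x,\theta\rangle-\psi^F(\theta)\}$, $\psi^F(\theta)=\log\int e^{\langle x,\theta\rangle}d\nu_F(x)$. The Fisher information $I_F(\vartheta)$ is the covariance matrix of $X$ under the distribution with $\nu_F$-density $p^F_\vartheta$ (defined whenever $\psi^F(\vartheta)<\infty$, as is the case for $\vartheta=\theta+\zeta$). Normal cone: $N_F=\{c\in\mathbb{R}^k: F\subseteq\{x\in\mathrm P:\langle c,x\rangle=\max_{y\in\mathrm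 P}\langle c,y\rangle\}\}$; $\mathrm{lin}(N_F)$ is its linear span. Non-identifiable means that distinct parameters can give the same distribution. *)

(* Defs.v *)
From mathcomp Require Import all_boot all_order all_algebra.
From mathcomp Require Import all_classical all_reals all_analysis.
Set Implicit Arguments.
Unset Strict Implicit.
Unset Printing Implicit Defensive.
Import Order.TTheory GRing.Theory Num.Theory.
Import numFieldNormedType.Exports.
Local Open Scope classical_set_scope.
Local Open Scope ring_scope.

Section geometry.
Context {R : realType} {k : nat}.
Implicit Types (P F S : set 'rV[R]_k) (x c : 'rV[R]_k).

Definition dot (x y : 'rV[R]_k) : R := \sum_(i < k) x 0 i * y 0 i.

Definition lin S : set 'rV[R]_k :=
  [set v | exists n (w : 'I_n -> R) (x : 'I_n -> 'rV[R]_k),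
     (forall i, S (x i)) /\ v = \sum_(i < n) w i *: x i].

Definition affhull S : set 'rV[R]_k :=
  [set v | exists n (w : 'I_n -> R) (x : 'I_n -> 'rV[R]_k),
     [/\ forall i, S (x i), \sum_(i < n) w i = 1
       & v = \sum_(i < n) w i *: x i]].

Definition convhull S : set 'rV[R]_k :=
  [set v | exists n (w : 'I_n -> R) (x : 'I_n -> 'rV[R]_k),
     [/\ forall i, S (x i), forall i, 0 <= w i, \sum_(i < n) w i = 1
       & v = \sum_(i < n) w i *: x i]].

(* [has_dim S d] means dim S = d.  It is a relation so that the empty set,
   whose affine hull is not a translate of a subspace, gets no dimension;
   [has_dim_uniq] shows that it is functional. *)
Definition has_dim S (d : nat) : Prop :=
  exists (x0 : 'rV[R]_k) (U : {vspace 'rV[R]_k}),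
    affhull S = [set x0 + u | u in [set u | u \in U]] /\ \dim U = d.

Lemma has_dim_uniq S d1 d2 : has_dim S d1 -> has_dim S d2 -> d1 = d2.
Proof.
move=> [x1 [U1 [E1 <-]]] [x2 [U2 [E2 <-]]]; congr (\dim _).
have {E1 E2} E : [set x1 + u | u in [set u | u \in U1]] =
                 [set x2 + u | u in [set u | u \in U2]] by rewrite -E1.
suff sub (y1 y2 : 'rV[R]_k) (V1 V2 : {vspace 'rV[R]_k}) :
    [set y1 + u | u in [set u | u \in V1]] =
    [set y2 + u | u in [set u | u \in V2]] -> (V1 <= V2)%VS.
  by apply/eqP; rewrite eqEsubv (sub x1 x2)//= (sub x2 x1).
move=> EV; apply/subvP => v vV1.
have [a aV2 ya] : [set y2 + u | u in [set u | u \in V2]] y1.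
  by rewrite -EV; exists 0; [exact: mem0v|rewrite addr0].
have [b bV2 yb] : [set y2 + u | u in [set u | u \in V2]] (y1 + v).
  by rewrite -EV; exists v.
suff -> : v = b - a by exact: rpredB.
by apply: (addrI y1); rewrite -yb -ya addrACA subrr addr0.
Qed.

Definition polyhedron P : Prop :=
  exists m (a : 'I_m -> 'rV[R]_k) (b : 'I_m -> R),
    P = [set x | forall i, dot (a i) x <= b i].

Definition maximizers P c : set 'rV[R]_k :=
  [set x | P x /\ forall y, P y -> dot c y <= dot c x].

(* Faces are nonempty; c = 0 gives the improper face P itself. *)
Definition is_face P F : Prop := F !=set0 /\ exists c, F = maximizers P c.

Definition proper_face P F : Prop := is_face P F /\ F <> P.

Definition normal_cone P F : set 'rV[R]_k := [set c | F `<=` maximizers P c].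

End geometry.

(* R^k with its Borel sigma-algebra. *)
Definition borelRk (R : realType) (k : nat) :=
  g_sigma_algebraType (@open 'rV[R]_k).

Section exponential_family.
Context {R : realType} {k : nat}.
Implicit Types (mu : set (borelRk R k) -> \bar R) (theta : 'rV[R]_k).

Definition atoms mu : set 'rV[R]_k := [set x | (0 < mu [set x])%E].

Definition supp mu : set 'rV[R]_k := closure (atoms mu).

Definition convex_support mu : set 'rV[R]_k := closure (convhull (supp mu)).

(* Same set function as [mrestr], without the measurability proof for F. *)
Definition restriction mu (F : set 'rV[R]_k) : set (borelRk R k) -> \bar R :=
  fun A => mu (A `&` F).

Definition laplace mu theta : \bar R :=
  (\int[mu]_x (expR (dot x theta))%:E)%E.

Definition logpart mu theta : \bar R := lne (laplace mu theta).

Definition density mu theta (x : borelRk R k) : R :=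
  expR (dot x theta - fine (logpart mu theta)).

Definition distr mu theta : set (borelRk R k) -> \bar R :=
  fun A => (\int[mu]_(x in A) (density mu theta x)%:E)%E.

Definition same_distr mu theta1 theta2 : Prop :=
  forall A : set (borelRk R k), measurable A ->
    distr mu theta1 A = distr mu theta2 A.

Definition nonidentifiable mu (Theta : set 'rV[R]_k) : Prop :=
  exists theta1 theta2, [/\ Theta theta1, Theta theta2, theta1 <> theta2
    & same_distr mu theta1 theta2].

Definition coord (i : 'I_k) (x : borelRk R k) : R := (x : 'rV[R]_k) 0 i.

Definition mean mu theta (i : 'I_k) : R :=
  fine (\int[distr mu theta]_x (coord i x)%:E)%E.

(* The covariance matrix of the coordinates under [distr mu theta], with the
   library's [covariance] written out because the latter requires a bundled
   probability; see [fisherE]. *)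
Definition fisher mu theta : 'M[R]_k :=
  \matrix_(i < k, j < k)
    fine (\int[distr mu theta]_x
      ((coord i x - mean mu theta i) * (coord j x - mean mu theta j))%:E)%E.

Lemma fisherE mu theta (Q : probability (borelRk R k) R) :
  (Q : set _ -> \bar R) = distr mu theta ->
  forall i j, fisher mu theta i j = fine (covariance Q (coord i) (coord j)).
Proof. by move=> QE i j; rewrite mxE /mean -QE !unlock. Qed.

End exponential_family.

(* Main.v *)
(* If [u] is constant on [F], every direction killed by the constraints active
   on [F] is killed by [u], so [u] lies in the span of the active normals, which
   belong to [N_F]; thus [lin N_F] is exactly the set of functionals constant on
   [F].  Since [F] is the convex hull of atoms, two parameters give the same
   distribution on [F] precisely when their difference is constant on [F], and a
   linear functional has zero variance precisely when it is constant on [F].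
   Hence identifiability is modulo [lin N_F], and the kernel of the Fisher
   information is the annihilator of the direction space of [F], which has
   codimension [dim F].  A proper face is exposed by some [c <> 0] in [N_F], and
   a small multiple of it moves a parameter inside the open set [Theta]. *)
From HB Require Import structures.
Require Import Defs.
From mathcomp Require Import all_boot all_order all_algebra.
From mathcomp Require Import all_classical all_reals all_analysis.
From mathcomp Require Import measurable_realfun ring lra.
Import Order.TTheory GRing.Theory Num.Theory.
Import numFieldNormedType.Exports.
Local Open Scope classical_set_scope.
Local Open Scope ring_scope.
Set Implicit Arguments.
Unset Strict Implicit.
Unset Printing Implicit Defensive.

(** * Dot product and functionals constant on a set *)

Section dot_theory.
Context {R : realType} {k : nat}.
Implicit Types (S : set 'rV[R]_k) (x y z : 'rV[R]_k) (a : R).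

Lemma dotC x y : dot x y = dot y x.
Proof. by apply: eq_bigr => i _; rewrite mulrC. Qed.

Lemma dotDl x y z : dot (x + y) z = dot x z + dot y z.
Proof. by rewrite -big_split; apply: eq_bigr => i _; rewrite mxE mulrDl. Qed.

Lemma dotZl a x z : dot (a *: x) z = a * dot x z.
Proof. by rewrite big_distrr; apply: eq_bigr => i _; rewrite mxE /= mulrA. Qed.

Lemma dotDr x y z : dot x (y + z) = dot x y + dot x z.
Proof. by rewrite dotC dotDl !(dotC x). Qed.

Lemma dotZr a x z : dot x (a *: z) = a * dot x z.
Proof. by rewrite dotC dotZl dotC. Qed.

Lemma dotBr x y z : dot x (y - z) = dot x y - dot x z.
Proof. by rewrite dotDr -scaleN1r dotZr mulN1r. Qed.

Lemma dot0l z : dot 0 z = 0.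
Proof. by rewrite -(scale0r 0) dotZl mul0r. Qed.

Lemma dot_sumr x n (y : 'I_n -> 'rV[R]_k) :
  dot x (\sum_i y i) = \sum_i dot x (y i).
Proof.
elim: n y => [|n IH] y; first by rewrite !big_ord0 dotC dot0l.
by rewrite !big_ord_recl dotDr IH.
Qed.

Lemma dot_delta x i : dot x (delta_mx 0 i) = x 0 i.
Proof.
rewrite /dot (bigD1 i)//= big1 ?addr0 ?mxE ?eqxx ?mulr1// => j ji.
by rewrite mxE (negbTE ji) andbF mulr0.
Qed.

Lemma dot_mulmx_col n (A : 'M[R]_(n, k)) (c : 'cV[R]_k) i :
  (A *m c) i 0 = dot c^T (row i A).
Proof. by rewrite mxE; apply: eq_bigr => j _; rewrite !mxE mulrC. Qed.

Definition constant_on (F : set 'rV[R]_k) u :=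
  forall x y, F x -> F y -> dot u x = dot u y.

Lemma convhull_nonempty S x : convhull S x -> S !=set0.
Proof.
move=> [[|n] [w [z [Sz _ w1 _]]]]; last by exists (z 0).
by move: w1; rewrite big_ord0 => /eqP; rewrite eq_sym oner_eq0.
Qed.

Lemma sub_convhull S : S `<=` convhull S.
Proof.
by move=> x Sx; exists 1%N, (fun=> 1), (fun=> x); rewrite !big_ord1 scale1r.
Qed.

Lemma constant_on_convhull S u x0 : S x0 ->
  (forall x, S x -> dot u x = dot u x0) ->
  constant_on (convhull S) u.
Proof.
move=> Sx0 uS.
suff cst x : convhull S x -> dot u x = dot u x0 by move=> x y /cst -> /cst ->.
move=> [n [w [z [Sz w0 w1 ->]]]].
rewrite dot_sumr -[RHS]mul1r -w1 mulr_suml; apply: eq_bigr => i _.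
by rewrite dotZr uS.
Qed.

End dot_theory.

(** * Affine combinations, directions, and dimension as a matrix rank *)

Section combinations.
Context {R : realType} {k : nat}.
Implicit Types (S : set 'rV[R]_k) (s t a : R) (u v : 'rV[R]_k).

(* [comb S 1] is [affhull S], and [comb S 0] is its direction. *)
Definition comb S s : set 'rV[R]_k :=
  [set v | exists n (w : 'I_n -> R) (x : 'I_n -> 'rV[R]_k),
     [/\ forall i, S (x i), \sum_(i < n) w i = s
       & v = \sum_(i < n) w i *: x i]].

Lemma combD S s t u v : comb S s u -> comb S t v -> comb S (s + t) (u + v).
Proof.
move=> [n [w [x [Sx <- ->]]]] [m [w' [x' [Sx' <- ->]]]].
exists (n + m)%N, (fun i : 'I_(n + m) =>
  match fintype.split i with inl j => w j | inr j => w' j end).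
exists (fun i : 'I_(n + m) =>
  match fintype.split i with inl j => x j | inr j => x' j end).
split; first by move=> i; case: fintype.split.
- rewrite big_split_ord /=; congr (_ + _); apply: eq_bigr => i _.
    by rewrite -[lshift m i]/(unsplit (inl i)) unsplitK.
  by rewrite -[rshift n i]/(unsplit (inr i)) unsplitK.
- rewrite big_split_ord /=; congr (_ + _); apply: eq_bigr => i _.
    by rewrite -[lshift m i]/(unsplit (inl i)) unsplitK.
  by rewrite -[rshift n i]/(unsplit (inr i)) unsplitK.
Qed.

Lemma combZ S s a u : comb S s u -> comb S (a * s) (a *: u).
Proof.
move=> [n [w [x [Sx <- ->]]]]; exists n, (fun i => a * w i), x; split => //.
  by rewrite mulr_sumr.
by rewrite scaler_sumr; apply: eq_bigr => i _; rewrite scalerA.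
Qed.

Lemma comb1 S u : S u -> comb S 1 u.
Proof.
by move=> Su; exists 1%N, (fun=> 1), (fun=> u); rewrite !big_ord1 scale1r.
Qed.

Lemma combB S s t u v : comb S s u -> comb S t v -> comb S (s - t) (u - v).
Proof.
by move=> Su /(combZ (-1)); rewrite mulN1r scaleN1r; exact: combD.
Qed.

Lemma affhullE S x0 : S x0 -> affhull S = [set x0 + u | u in comb S 0].
Proof.
move=> /comb1 Sx0; apply/seteqP; split => [v Sv|_ [u Su <-]].
  by exists (v - x0); [rewrite -(subrr 1); exact: combB|rewrite addrC subrK].
by rewrite -[affhull S]/(comb S 1) -(addr0 1); exact: combD.
Qed.

(** If [u] is constant on [S], weights of sum 0 cancel its common value; conversely, a difference of
    two points of [S] is a combination with weights of sum 0. *)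
Lemma constant_onP S u : constant_on S u <-> forall v, comb S 0 v -> dot u v = 0.
Proof.
split=> [cS v [n [w [x [Sx w0 ->]]]]|u0 x y Sx Sy].
  rewrite dot_sumr; case: n w x Sx w0 => [|n] w x Sx w0; first by rewrite big_ord0.
  rewrite -[RHS](mul0r (dot u (x 0))) -[in RHS]w0 mulr_suml.
  by apply: eq_bigr => i _; rewrite dotZr (cS _ (x 0)).
apply/eqP; rewrite -subr_eq0 -dotBr; apply/eqP/u0.
by rewrite -(subrr 1); apply: combB; exact: comb1.
Qed.

(** Dimensions of subspaces inside [D] are bounded by [k], so one of them is maximal. It exhausts
    [D], since adjoining any missing vector would enlarge it. *)
Lemma linear_set_vspace (D : set 'rV[R]_k) : D 0 ->
  (forall a u v, D u -> D v -> D (a *: u + v)) ->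
  exists U : {vspace 'rV[R]_k}, D = [set u | u \in U].
Proof.
move=> D0 Dlin.
pose p d := `[< exists U : {vspace 'rV[R]_k},
  [set u | u \in U] `<=` D /\ \dim U = d >].
have p0 : exists d, p d.
  exists 0%N; apply/asboolP; exists 0%VS; split; last exact: dimv0.
  by move=> u /=; rewrite memv0 => /eqP ->.
have pk d : p d -> (d <= k)%N.
  move=> /asboolP[U [_ <-]]; rewrite (leq_trans (dimvS (subvf U)))//.
  by rewrite dimvf /dim /= mul1n.
case: (ex_maxnP p0 pk) => d /asboolP[U [UD Ud]] dmax.
exists U; apply/seteqP; split=> // u Du /=; apply/contraT => uU.
have /dmax : p (\dim (U + <[u]>)%VS).
  apply/asboolP; exists (U + <[u]>)%VS; split => // z /memv_addP[a aU].
  by move=> [_ /vlineP[c ->] ->]; rewrite addrC; apply: Dlin => //; exact: UD.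
rewrite -Ud => dimUu.
have : (U + <[u]>)%VS == U by rewrite eq_sym eqEdim addvSl.
by move=> /eqP UE; move: uU; rewrite memvE -UE addvSr.
Qed.

(** Put a basis of [U] into the rows of [B]. Then [A] and [B] have the same right kernel, hence the
    same row space and the same rank. *)
Lemma dim_eq_rank (U : {vspace 'rV[R]_k}) (A : 'M[R]_k) :
  (forall c : 'cV[R]_k, A *m c = 0 <-> forall u, u \in U -> dot c^T u = 0) ->
  \dim U = \rank A.
Proof.
move=> UA; pose B := \matrix_(i < \dim U) (vbasis U)`_i.
have -> : \dim U = \rank B.
  apply/esym/eqP; change (row_free B); rewrite -kermx_eq0.
  apply/eqP/row_matrixP => i; rewrite row0.
  have kB : row i (kermx B) *m B = 0.
    by rewrite -row_mul mulmx_ker row0.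
  apply/rowP => j; rewrite [RHS]mxE.
  have /freeP := basis_free (vbasisP U); apply.
  rewrite -[RHS]kB mulmx_sum_row; apply: eq_bigr => l _.
  by rewrite rowK.
have UB (c : 'cV[R]_k) : A *m c = 0 <-> B *m c = 0.
  rewrite UA; split=> [cU|Bc u uU].
    apply/colP => i; rewrite dot_mulmx_col rowK mxE; apply/cU.
    by rewrite vbasis_mem// mem_nth// size_tuple.
  rewrite (coord_vbasis uU) dot_sumr big1// => i _.
  rewrite dotZr -[X in dot _ X](rowK (fun i : 'I__ => (vbasis U)`_i)).
  by rewrite -dot_mulmx_col Bc mxE mulr0.
(* Inclusion of right kernels reverses for row spaces: the columns of the cokernel of [D] are killed
   by [D], hence by [C]. *)
have sub m n (C : 'M[R]_(m, k)) (D : 'M[R]_(n, k)) :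
    (forall c : 'cV[R]_k, D *m c = 0 -> C *m c = 0) -> (C <= D)%MS.
  move=> DC; rewrite submxE; apply/eqP/matrixP => i j; rewrite [RHS]mxE.
  have /DC/colP/(_ i) : D *m col j (cokermx D) = 0.
    by rewrite colE mulmxA mulmx_coker mul0mx.
  by rewrite colE mulmxA -colE !mxE.
by apply/eqP; rewrite eqn_leq !mxrankS// sub// => c /UB.
Qed.

(** The affine hull is a translate of [comb S 0], and the functionals constant on [S] are those
    vanishing on [comb S 0]; so the kernel of [A] is the annihilator of the direction space. *)
Lemma has_dim_rank S (A : 'M[R]_k) : S !=set0 ->
  (forall c : 'cV[R]_k, A *m c = 0 <-> constant_on S c^T) ->
  has_dim S (\rank A).
Proof.
move=> [x0 Sx0] SA.
have [|a u v Su Sv|U UE] := @linear_set_vspace (comb S 0).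
- by rewrite -(subrr x0) -(subrr 1); apply: combB; exact: comb1.
- by rewrite -(addr0 0) -[X in X + 0](mulr0 a); apply: combD => //; exact: combZ.
- exists x0, U; rewrite (affhullE Sx0) UE; split => //; apply: dim_eq_rank => c.
  rewrite SA constant_onP UE; split=> h u; exact: h.
Qed.

End combinations.

(** * Normal cone of a face of a polyhedron *)

Section polyhedra.
Context {R : realType} {k : nat}.
Implicit Types (P F : set 'rV[R]_k) (x c u : 'rV[R]_k).

Lemma lin_normal_cone_constant P F u : lin (normal_cone P F) u -> constant_on F u.
Proof.
move=> [n [w [x [Nx ->]]]] y z Fy Fz.
rewrite !(dotC (\sum_i _)) !dot_sumr; apply: eq_bigr => i _.
rewrite !dotZr; congr (_ * _); rewrite !(dotC _ (x i)).
have [Py My] := Nx i _ Fy; have [Pz Mz] := Nx i _ Fz.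
by apply/eqP; rewrite eq_le My// Mz.
Qed.

(** This yields a point as in the relative interior. The constraints are treated one at a time: the
    midpoint with a witness of strictness becomes strict for the new constraint and stays strict for
    the earlier ones. *)
Lemma strict_point m (a : 'I_m -> 'rV[R]_k) (b : 'I_m -> R) F :
  F !=set0 -> (forall x, F x -> forall i, dot (a i) x <= b i) ->
  (forall x y, F x -> F y -> F (2^-1 *: (x + y))) ->
  exists2 x, F x &
    forall i, (exists2 y, F y & dot (a i) y < b i) -> dot (a i) x < b i.
Proof.
move=> [x0 Fx0] Fle Fmid.
suff [x Fx xs] : exists2 x, F x & forall i, i \in enum 'I_m ->
    (exists2 y, F y & dot (a i) y < b i) -> dot (a i) x < b i.
  by exists x => // i; apply: xs; rewrite mem_enum.
elim: (enum 'I_m) => [|i s [x Fx xs]]; first by exists x0.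
have [[y Fy yi]|ni] := pselect (exists2 y, F y & dot (a i) y < b i); last first.
  by exists x => // j; rewrite inE => /orP[/eqP -> /ni|/xs].
exists (2^-1 *: (x + y)); first exact: Fmid.
move=> j js hj; rewrite dotZr dotDr.
have := Fle _ Fx j; have := Fle _ Fy j.
move: js; rewrite inE => /orP[/eqP ->|/xs/(_ hj)]; first by move: yi; lra.
by lra.
Qed.

(** Each constraint slack at [x] allows a positive step along [d], and finitely many positive bounds
    have a positive minimum. *)
Lemma small_step m (a : 'I_m -> 'rV[R]_k) (b : 'I_m -> R) x d :
  exists2 e : R, 0 < e &
    forall i, dot (a i) x < b i -> dot (a i) (x + e *: d) <= b i.
Proof.
(* Claiming the bound for every [e'] in []0, e]] lets the induction shrink [e] freely. *)
suff [e e0 es] : exists2 e : R, 0 < e & forall e' i, i \in enum 'I_m -> 0 < e' <= e ->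
    dot (a i) x < b i -> dot (a i) (x + e' *: d) <= b i.
  by exists e => // i; apply: es; rewrite ?mem_enum// e0 lexx.
elim: (enum 'I_m) => [|i s [e e0 es]]; first by exists 1.
have [xi|xi] := ltP (dot (a i) x) (b i); last first.
  exists e => // e' j; rewrite inE => /orP[/eqP -> _|/es]; last exact.
  by rewrite ltNge xi.
(* The bound is slack over slope; the added 1 keeps the denominator positive when the slope is 0. *)
have q0 : 0 < (b i - dot (a i) x) / (1 + `|dot (a i) d|).
  by rewrite divr_gt0 ?subr_gt0 ?ltr_pwDl.
exists (Num.min e ((b i - dot (a i) x) / (1 + `|dot (a i) d|))).
  by rewrite lt_min e0.
move=> e' j js; rewrite le_min => /and3P[e'0 e'e].
rewrite ler_pdivlMr ?ltr_pwDl// => e'q.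
move: js; rewrite inE => /orP[/eqP -> _|js]; last by apply: es; rewrite ?e'0.
rewrite dotDr dotZr.
have : e' * dot (a i) d <= e' * `|dot (a i) d| by rewrite ler_wpM2l ?ler_norm ?ltW.
by move: e'q e'0; rewrite mulrDr; lra.
Qed.

(* A direction killed by the constraints active on the face can be followed
   inside the face from a point where the others are strict, so [u] kills it;
   hence [u] is a combination of the active normals, which lie in [N_F]. *)
Lemma constant_lin_normal_cone P F u : polyhedron P -> is_face P F ->
  constant_on F u -> lin (normal_cone P F) u.
Proof.
move=> [m [a [b PE]]] [F0 [c FE]] uF.
have FP x : F x -> P x by rewrite FE => -[].
have Fle x : F x -> forall i, dot (a i) x <= b i by move=> /FP; rewrite PE.
have Fmid x y : F x -> F y -> F (2^-1 *: (x + y)).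
  move=> Fx Fy; have := Fle _ Fx; have := Fle _ Fy.
  move: Fx Fy; rewrite FE => -[Px Mx] [Py My] ay ax; split.
    rewrite PE => i /=; rewrite dotZr dotDr.
    by have := ax i; have := ay i; lra.
  move=> z Pz; rewrite dotZr dotDr; have := Mx _ Pz; have := My _ Pz; lra.
have [x Fx xs] := strict_point F0 Fle Fmid.
pose act i := `[< forall y, F y -> dot (a i) y = b i >].
have nact i : ~~ act i -> dot (a i) x < b i.
  move=> /asboolPn/existsNP[y /not_implyP[Fy /eqP yb]]; apply: xs; exists y => //.
  by rewrite lt_neqAle yb Fle.
pose a' i := if act i then a i else 0.
have a'N i : normal_cone P F (a' i).
  move=> y Fy; split; first exact: FP.
  rewrite /a'; case: ifPn => [/asboolP acti z|_ z _]; last by rewrite !dot0l.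
  by rewrite PE (acti y)//; apply.
pose A := \matrix_i a' i.
suff /submxP[w uE] : (u <= A)%MS.
  exists m, (w 0), a'; split=> //; rewrite uE mulmx_sum_row.
  by apply: eq_bigr => i _; rewrite rowK.
rewrite submxE; apply/eqP/rowP => j; rewrite [RHS]mxE.
(* The columns of the cokernel span the right kernel of [A], so [u] lies in the row space of [A] as
   soon as it kills each such [d]. *)
pose d := (col j (cokermx A))^T.
have dact i : act i -> dot (a i) d = 0.
  move=> acti; have /colP/(_ i) : A *m col j (cokermx A) = 0.
    by rewrite colE mulmxA mulmx_coker mul0mx.
  by rewrite dot_mulmx_col rowK mxE /a' acti dotC.
have -> : (u *m cokermx A) 0 j = dot u d.
  by rewrite !mxE; apply: eq_bigr => l _; rewrite !mxE.
have [e e0 es] := small_step a b x d.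
have Fd : F (x + e *: d).
  have Pd z : (forall i, act i -> dot (a i) z = b i) ->
      (forall i, ~~ act i -> dot (a i) z <= b i) -> P z.
    rewrite PE => h1 h2 i /=.
    by have [/h1 ->|/h2] := boolP (act i).
  have acte i t : act i -> dot (a i) (x + t *: d) = b i.
    by move=> acti; rewrite dotDr dotZr dact// mulr0 addr0 (asboolP _ acti).
  have Px : P (x + e *: d).
    by apply: Pd => i ?; [exact: acte|exact/es/nact].
  (* A backward step also stays in [P]; maximality of [x] then gives [dot c d >= 0], so the forward
     point is a maximizer too. *)
  have [e' e'0 e's] := small_step a b x (- d).
  have Px' : P (x - e' *: d).
    apply: Pd => i ai; first by rewrite -scaleNr acte.
    by rewrite -scalerN; exact/e's/nact.
  move: Fx; rewrite FE => -[_ Mx]; split => // z Pz; apply: le_trans (Mx _ Pz) _.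
  have := Mx _ Px'; rewrite dotBr dotDr !dotZr => h.
  have : 0 <= e' * dot c d by lra.
  by rewrite pmulr_rge0// => cd; rewrite lerDl mulr_ge0// ltW.
have := uF _ _ Fd Fx; rewrite dotDr dotZr => /eqP.
by rewrite -subr_eq0 addrC addKr mulf_eq0 gt_eqF//= => /eqP.
Qed.

End polyhedra.

(** * Measures given by a density *)

Section density_measure.
Context d (T : measurableType d) (R : realType).
Variables (mu : {measure set T -> \bar R}) (p : T -> R).
Local Open Scope ereal_scope.

(** The two proofs are parameters so that a measure structure can be attached to the bare set
    function, which for an exponential density is convertible to [distr]. *)
Definition mdensity (p0 : forall x, (0 <= p x)%R) (mp : measurable_fun setT p) :
  set T -> \bar R := fun A => \int[mu]_(x in A) (p x)%:E.

Hypotheses (p0 : forall x, (0 <= p x)%R) (mp : measurable_fun setT p).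
Local Notation Q := (mdensity p0 mp).

Let mdensity0 : Q set0 = 0. Proof. exact: integral_set0. Qed.

Let mdensity_ge0 A : 0 <= Q A.
Proof. by apply: integral_ge0 => x _; rewrite lee_fin. Qed.

Let mdensity_sigma_additive : semi_sigma_additive Q.
Proof.
move=> /= F mF tF mUF; rewrite /mdensity; apply: cvg_toP.
  apply: ereal_nondecreasing_is_cvgn => m n mn.
  by apply: lee_sum_nneg_natr => // *; exact: mdensity_ge0.
rewrite ge0_integral_bigcup//=.
  by apply/measurable_EFinP; exact: measurable_funS mp.
by move=> x _; rewrite lee_fin.
Qed.

HB.instance Definition _ := isMeasure.Build _ _ _ Q
  mdensity0 mdensity_ge0 mdensity_sigma_additive.

Import HBNNSimple.

(** Monotone convergence along simple approximations [h n] reduces the claim to simple functions,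
    where both sides are finite sums over the values [r] of [r] times the [Q]-mass of a level
    set. *)
Lemma ge0_integral_mdensity (f : T -> \bar R) : (forall x, 0 <= f x) ->
  measurable_fun setT f -> \int[Q]_x f x = \int[mu]_x (f x * (p x)%:E).
Proof.
move=> f0 mf; pose h := nnsfun_approx measurableT mf.
have hf x : EFin \o h^~ x @ \oo --> f x by exact: cvg_nnsfun_approx.
have h_nd x : {homo (fun n => (h n x)%:E) : n m / (n <= m)%N >-> n <= m}.
  by move=> n m nm; rewrite lee_fin; exact/lefP/nd_nnsfun_approx.
have mh n : measurable_fun setT (fun x => (h n x)%:E) by exact/measurable_EFinP.
have mpE : measurable_fun setT (EFin \o p) by exact/measurable_EFinP.
have -> : \int[Q]_x f x = limn (fun n => \int[Q]_x (h n x)%:E).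
  rewrite -monotone_convergence//; last by move=> n x _; rewrite lee_fin.
  by apply: eq_integral => x _; apply/esym/cvg_lim => //; exact: hf.
have -> : \int[mu]_x (f x * (p x)%:E) =
    limn (fun n => \int[mu]_x ((h n x)%:E * (p x)%:E)).
  rewrite -monotone_convergence//.
  - apply: eq_integral => x _; apply/esym/cvg_lim => //.
    by apply: cvgeZr => //; exact: hf.
  - by move=> n; exact: emeasurable_funM.
  - by move=> n x _; rewrite mule_ge0// lee_fin.
  - by move=> x _ n m nm; rewrite lee_wpmul2r ?lee_fin//; have := h_nd x _ _ nm.
congr (limn _); apply/funext => n.
have mi r : measurable_fun setT (fun x => (\1_(h n @^-1` [set r]) x)%:E : \bar R).
  exact/measurable_EFinP.
rewrite integral_nnsfun// patch_setT sintegralE.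
transitivity (\int[mu]_x \sum_(r \in range (h n))
    ((r * \1_(h n @^-1` [set r]) x)%:E * (p x)%:E)); last first.
  apply: eq_integral => x _; rewrite [in RHS]fimfunE -fsumEFin//.
  by rewrite ge0_mule_fsuml// => r; exact: nnfun_muleindic_ge0.
rewrite ge0_integral_fsum//; last 2 first.
- move=> r; apply: emeasurable_funM => //.
  by apply/measurable_EFinP; exact: measurable_funM.
- by move=> r x _; apply: mule_ge0; [exact: nnfun_muleindic_ge0|rewrite lee_fin].
apply: eq_fsbigr => r; rewrite inE => -[x _ hxr].
have r0 : (0 <= r)%R by rewrite -hxr.
under [RHS]eq_integral do rewrite EFinM -muleA.
rewrite ge0_integralZl//.
- congr (_ * _); rewrite /= /mdensity integral_mkcond; apply: eq_integral => y _.
  by rewrite epatch_indic muleC.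
- exact: emeasurable_funM.
- by move=> y _; rewrite mule_ge0 ?lee_fin.
Qed.

End density_measure.

(** * Restriction, null sets and finite linear combinations of integrals *)

Section measure_lemmas.
Context d (T : measurableType d) (R : realType).
Variable mu : {measure set T -> \bar R}.
Local Open Scope ereal_scope.

(** The restriction has density [\1_F], which is at most 1. *)
Lemma ge0_integral_mrestr_le (F : set T) (mF : measurable F) (f : T -> \bar R) :
  (forall x, 0 <= f x) -> measurable_fun setT f ->
  \int[mrestr mu mF]_x f x <= \int[mu]_x f x.
Proof.
move=> f0 mf; have F0 x : (0 <= \1_F x :> R)%R by rewrite indicE.
have m1 : measurable_fun setT (\1_F : T -> R) by exact: measurable_indic.
rewrite [leLHS](eq_measure_integral (mdensity mu F0 m1)); last first.
  by move=> A mA _; rewrite /= /mdensity integral_indic// setIC.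
rewrite ge0_integral_mdensity//; apply: ge0_le_integral => //.
- by move=> x _; rewrite mule_ge0// lee_fin.
- by apply: emeasurable_funM => //; exact/measurable_EFinP.
- move=> x _; rewrite -[leRHS]mule1 lee_wpmul2l// lee_fin indicE.
  by case: (x \in F).
Qed.

Lemma integral_set1_cst (f : T -> R) a : measurable [set a] ->
  \int[mu]_(x in [set a]) (f x)%:E = (f a)%:E * mu [set a].
Proof.
move=> ma; rewrite -integral_cst//; apply: eq_integral => x.
by rewrite inE => ->.
Qed.

Lemma ae_eq_of_null (F : set T) (D : set T) (f g : T -> \bar R) :
  measurable F -> mu (~` F) = 0 -> (forall x, F x -> f x = g x) ->
  ae_eq mu D f g.
Proof.
move=> mF F0 fg; exists (~` F); split => //; first exact: measurableC.
by move=> x /= /not_implyP[_ nfg] Fx; apply: nfg; exact: fg.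
Qed.

Lemma integrable_lincomb n (c : 'I_n -> R) (f : 'I_n -> T -> R) :
  (forall j, mu.-integrable setT (EFin \o f j)) ->
  mu.-integrable setT (fun x => (\sum_j c j * f j x)%:E).
Proof.
move=> If; under eq_fun do rewrite -sumEFin.
apply: integrable_sum => // j _; under eq_fun do rewrite EFinM.
exact: integrableZl (If j).
Qed.

Lemma fine_integral_lincomb n (c : 'I_n -> R) (f : 'I_n -> T -> R) :
  (forall j, mu.-integrable setT (EFin \o f j)) ->
  fine (\int[mu]_x (\sum_j c j * f j x)%:E) =
  (\sum_j c j * fine (\int[mu]_x (f j x)%:E))%R.
Proof.
move=> If; under eq_integral do rewrite -sumEFin.
have IZ j : mu.-integrable setT (fun x => (c j * f j x)%:E).
  by under eq_fun do rewrite EFinM; exact: integrableZl (If j).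
rewrite integral_sum// -sum_fine => [|j _]; last exact: integrable_fin_num.
apply: eq_bigr => j _; under eq_integral do rewrite EFinM.
rewrite (integralZl measurableT (If j)) fineM//.
exact: (integrable_fin_num measurableT (If j)).
Qed.

End measure_lemmas.

(** * Borel measurability in R^k *)

Section borelRk_theory.
Context {R : realType} {k : nat}.

Lemma open_measurable_borelRk (A : set 'rV[R]_k) : open A ->
  measurable (A : set (borelRk R k)).
Proof. by move=> oA; apply: sub_sigma_algebra. Qed.

Lemma closed_measurable_borelRk (A : set 'rV[R]_k) : closed A ->
  measurable (A : set (borelRk R k)).
Proof.
move=> cA; rewrite -[A]setCK.
by apply: measurableC; apply: open_measurable_borelRk; exact: closed_openC.
Qed.

Lemma measurable_set1_borelRk (x : 'rV[R]_k) :
  measurable ([set x] : set (borelRk R k)).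
Proof.
apply: closed_measurable_borelRk; apply: accessible_closed_set1.
by apply: hausdorff_accessible; exact: norm_hausdorff.
Qed.

Lemma measurable_coord i : measurable_fun setT (@Defs.coord R k i).
Proof.
apply: (measurability _ (RGenOpens.measurableE R)) => _ [_ [a [b ->] <-]].
rewrite setTI; apply: open_measurable_borelRk.
have /continuousP := @coord_continuous R 1 k 0 i; apply; exact: interval_open.
Qed.

Lemma measurable_dot (theta : 'rV[R]_k) :
  measurable_fun setT (fun x : borelRk R k => dot x theta).
Proof.
apply: measurable_sum => i; apply: measurable_funM => //.
exact: measurable_coord.
Qed.

Lemma measurable_expR_dot (theta : 'rV[R]_k) :
  measurable_fun setT (fun x : borelRk R k => (expR (dot x theta))%:E).
Proof.
apply/measurable_EFinP; apply: measurableT_comp => //; exact: measurable_dot.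
Qed.

(** A face is the closed set [P] cut by a level set of the functional exposing it. *)
Lemma measurable_face (P F : set 'rV[R]_k) : closed P -> is_face P F ->
  measurable (F : set (borelRk R k)).
Proof.
move=> cP [[x0 Fx0] [c FE]].
have -> : F = P `&` ((fun x : borelRk R k => dot x c) @^-1` [set dot x0 c]).
  move: Fx0; rewrite FE => -[Px0 M0]; apply/seteqP; split=> x /= [Px].
    move=> Mx; split => //; apply/eqP; rewrite !(dotC _ c) eq_le M0// Mx//.
  by rewrite !(dotC _ c) => xE; split => // y Py; rewrite xE; exact: M0.
apply: measurableI; first exact: closed_measurable_borelRk.
by rewrite -[X in measurable X]setTI; exact: measurable_dot.
Qed.

End borelRk_theory.

(** * Kernel of the covariance matrix *)

Section covariance_kernel.
Context {R : realType} {k : nat}.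
Variable Q : {measure set (borelRk R k) -> \bar R}.
Variables F S : set 'rV[R]_k.
Hypotheses (Q1 : Q setT = 1%E) (mF : measurable (F : set (borelRk R k)))
  (QF : Q (~` F) = 0%E) (FS : F = convhull S) (F0 : F !=set0)
  (SQ : forall x, S x -> (0 < Q [set x])%E)
  (Isq : forall i, Q.-integrable setT (fun x => (Defs.coord i x ^+ 2)%:E)).

Let m i := fine (\int[Q]_x (Defs.coord i x)%:E)%E.

Definition cov_mx : 'M[R]_k := \matrix_(i, j)
  fine (\int[Q]_x ((Defs.coord i x - m i) * (Defs.coord j x - m j))%:E)%E.

Let Icst (r : R) : Q.-integrable setT (fun=> r%:E).
Proof.
apply/integrableP; split => //.
by rewrite integral_cst// Q1 mule1 ltry.
Qed.

Let Icoord i : Q.-integrable setT (EFin \o Defs.coord i).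
Proof.
(* The dominating function is [1 + x_i^2], integrable since [Q] has total mass 1. *)
apply: (le_integrable measurableT _ _ (integrableD measurableT (Icst 1) (Isq i))).
  by apply/measurable_EFinP; exact: measurable_coord.
move=> x _ /=; rewrite lee_fin [leRHS]ger0_norm ?addr_ge0 ?sqr_ge0//.
by rewrite ler_norml; apply/andP; split; nra.
Qed.

Let Iprod i j : Q.-integrable setT
  (fun x => ((Defs.coord i x - m i) * (Defs.coord j x - m j))%:E).
Proof.
(* By [|st| <= (s^2 + t^2) / 2] and [(x - m)^2 <= 2 x^2 + 2 m^2], the product of centered
   coordinates is at most [b i + b j]. *)
pose b i (x : borelRk R k) := (2 * Defs.coord i x ^+ 2 + 2 * m i ^+ 2)%:E.
have Ib l : Q.-integrable setT (b l).
  under [b l]eq_fun do rewrite EFinD EFinM.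
  by apply: integrableD => //; exact: integrableZl (Isq l).
apply: (le_integrable measurableT _ _ (integrableD measurableT (Ib i) (Ib j))).
  apply/measurable_EFinP; apply: measurable_funM;
  by apply: measurable_funB => //; exact: measurable_coord.
have sq2 (r : R) : 0 <= 2 * r ^+ 2 by rewrite mulr_ge0 ?sqr_ge0.
move=> x _ /=; rewrite lee_fin [leRHS]ger0_norm; last by rewrite !addr_ge0.
rewrite ler_norml; move: (Defs.coord i x) (Defs.coord j x) (m i) (m j) => a b' c d.
have := sqr_ge0 (a - c + (b' - d)); have := sqr_ge0 (a - c - (b' - d)).
have := sqr_ge0 (a + c); have := sqr_ge0 (b' + d).
by move=> *; apply/andP; split; nra.
Qed.

Let dotm (c : 'cV[R]_k) : R := \sum_j c j 0 * m j.

Let centered (c : 'cV[R]_k) (x : borelRk R k) :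
  \sum_j c j 0 * (Defs.coord j x - m j) = dot c^T x - dotm c.
Proof.
by rewrite -sumrB; apply: eq_bigr => j _; rewrite mxE mulrBr.
Qed.

Let cov_mx_mul (c : 'cV[R]_k) i : (cov_mx *m c) i 0 =
  fine (\int[Q]_x ((Defs.coord i x - m i) * (dot c^T x - dotm c))%:E)%E.
Proof.
rewrite mxE.
under eq_bigr do rewrite mxE mulrC.
rewrite -(fine_integral_lincomb _ (fun j => Iprod i j)); congr fine.
apply: eq_integral => x _; rewrite -centered mulr_sumr; congr EFin.
by apply: eq_bigr => j _; rewrite mulrCA.
Qed.

Let Isqdot (c : 'cV[R]_k) : Q.-integrable setT
  (fun x => ((dot c^T x - dotm c) ^+ 2)%:E).
Proof.
rewrite (_ : (fun x => _) = fun x => (\sum_i c i 0 * (\sum_j c j 0 *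
    ((Defs.coord i x - m i) * (Defs.coord j x - m j))))%:E); last first.
  apply/funext => x; rewrite -centered expr2 mulr_suml; congr EFin.
  apply: eq_bigr => i _; rewrite -mulrA mulr_sumr; congr (_ * _).
  by apply: eq_bigr => j _; rewrite mulrCA.
apply: integrable_lincomb => i; apply: integrable_lincomb => j; exact: Iprod.
Qed.

(** The quadratic form of the covariance matrix at [c] is the variance of the functional [c]. *)
Let cov_mx_var (c : 'cV[R]_k) : cov_mx *m c = 0 ->
  (\int[Q]_x ((dot c^T x - dotm c) ^+ 2)%:E = 0)%E.
Proof.
move=> Qc; rewrite -[LHS]fineK; last exact: (integrable_fin_num measurableT (Isqdot c)).
congr EFin; transitivity (\sum_i c i 0 * (cov_mx *m c) i 0); last first.
  by rewrite big1// => i _; rewrite Qc mxE mulr0.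
have -> : (\int[Q]_x ((dot c^T x - dotm c) ^+ 2)%:E = \int[Q]_x
    (\sum_i c i 0 * ((Defs.coord i x - m i) * (dot c^T x - dotm c)))%:E)%E.
  apply: eq_integral => x _; rewrite expr2 -[X in X * _]centered mulr_suml.
  by congr EFin; apply: eq_bigr => i _; rewrite mulrA.
rewrite fine_integral_lincomb => [|i].
  by apply: eq_bigr => i _; rewrite cov_mx_mul.
rewrite (_ : EFin \o _ = fun x => (\sum_j c j 0 *
    ((Defs.coord i x - m i) * (Defs.coord j x - m j)))%:E).
  by apply: integrable_lincomb => j; exact: Iprod.
apply/funext => x /=; rewrite -centered mulr_sumr; congr EFin.
by apply: eq_bigr => j _; rewrite mulrCA.
Qed.

(** Zero variance makes the functional equal to its mean almost everywhere, hence at the points of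
    [S] and on their convex hull. Conversely, a functional constant on a set of full mass equals its
    mean there, so its covariance with every coordinate vanishes. *)
Lemma cov_mx_mul_eq0 (c : 'cV[R]_k) : cov_mx *m c = 0 <-> constant_on F c^T.
Proof.
split=> [/cov_mx_var int0|cF].
  have {int0} : (\int[Q]_x `|((dot c^T x - dotm c) ^+ 2)%:E| = 0)%E.
    rewrite -[RHS]int0; apply: eq_integral => x _.
    by rewrite gee0_abs// lee_fin sqr_ge0.
  move=> /(ae_eq_integral_abs _ measurableT (measurable_int _ (Isqdot c))).
  move=> [N [mN QN0 Nsub]].
  have cS x : S x -> dot c^T x = dotm c.
    move=> Sx; apply/eqP; rewrite -subr_eq0 -sqrf_eq0; apply/eqP.
    apply: contrapT => nx.
    (* A point of [S] violating the equality would lie in the null set [N], yet it carries positive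
       mass. *)
    have Nx : N x by apply: Nsub => /= /(_ Logic.I)[].
    have := SQ Sx; rewrite ltNge => /negP; apply; rewrite -QN0.
    by apply: le_measure; rewrite ?inE//; [exact: measurable_set1_borelRk|move=> _ ->].
  have [x0] := F0; rewrite FS => /convhull_nonempty[a Sa].
  by apply: (constant_on_convhull Sa) => x /cS ->; rewrite cS.
move: F0 => [x0 Fx0].
have dotmE : dotm c = dot c^T x0.
  rewrite /dotm -(fine_integral_lincomb _ Icoord).
  rewrite (@ae_eq_integral _ _ _ _ _ (cst (dot c^T x0)%:E))//.
  - by rewrite integral_cst// Q1 mule1.
  - exact: (measurable_int _ (integrable_lincomb _ Icoord)).
  - apply: (ae_eq_of_null _ mF QF) => x Fx /=; rewrite (cF _ _ Fx0 Fx).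
    by congr EFin; apply: eq_bigr => j _; rewrite mxE.
apply/colP => i; rewrite cov_mx_mul [RHS]mxE.
rewrite (@ae_eq_integral _ _ _ _ _ (cst 0%:E))//.
- by rewrite integral_cst// mul0e.
- apply/measurable_EFinP; apply: measurable_funM; apply: measurable_funB => //.
    exact: measurable_coord.
  by apply: eq_measurable_fun (measurable_dot c^T) => x _; exact: dotC.
- apply: (ae_eq_of_null _ mF QF) => x Fx /=.
  by rewrite dotmE (cF _ _ Fx Fx0) subrr mulr0.
Qed.

End covariance_kernel.

(** The step is half the radius of a ball inside [Theta], divided by [1 + |v|] so that [v = 0] is
    allowed. *)
Lemma open_line {R : realType} {k : nat} (Theta : set 'rV[R]_k) theta v :
  open Theta -> Theta theta ->
  exists2 e : R, 0 < e & forall t, `|t| <= e -> Theta (theta + t *: v).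
Proof.
move=> oT Tt; have /nbhs_ballP[d /= d0 dT] : nbhs theta Theta.
  exact: open_nbhs_nbhs.
have v0 : 0 < 1 + `|v| by rewrite ltr_pwDl.
exists (d / 2 / (1 + `|v|)); first by rewrite !divr_gt0.
move=> t; rewrite ler_pdivlMr// => te; apply: dT.
rewrite -ball_normE /= opprD addrA subrr add0r normrN normrZ.
have : `|t| * `|v| <= `|t| * (1 + `|v|) by rewrite ler_wpM2l// lerDr.
by lra.
Qed.

(** * Normalization, equality of distributions and Fisher information *)

Section exponential_family.
Context {R : realType} {k : nat}.
Variable mu : {measure set (borelRk R k) -> \bar R}.
Implicit Types (theta x : 'rV[R]_k) (F : set 'rV[R]_k).

Lemma density_ge0 theta (x : borelRk R k) : 0 <= density mu theta x.
Proof. exact: expR_ge0. Qed.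

Lemma measurable_density theta : measurable_fun setT (density mu theta).
Proof.
apply: measurableT_comp => //; apply: measurable_funB => //.
exact: measurable_dot.
Qed.

Lemma laplace_ge_atom theta a :
  ((expR (dot a theta))%:E * mu [set a] <= laplace mu theta)%E.
Proof.
rewrite -(integral_set1_cst mu (fun x => expR (dot x theta)))//; last first.
  exact: measurable_set1_borelRk.
apply: ge0_subset_integral => //; first exact: measurable_set1_borelRk.
exact: measurable_expR_dot.
Qed.

Lemma laplace_gt0 theta a : atoms mu a -> (0 < laplace mu theta)%E.
Proof.
move=> /= mua; apply: lt_le_trans (laplace_ge_atom theta a).
by rewrite mule_gt0// lte_fin expR_gt0.
Qed.

(** An atom of infinite mass would make the Laplace transform infinite, since the exponential is
    positive. *)
Lemma atom_fin_num theta a : (laplace mu theta < +oo)%E ->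
  mu [set a] \is a fin_num.
Proof.
move=> /(le_lt_trans (laplace_ge_atom theta a)).
rewrite ge0_fin_numE//; case: (mu [set a]) => [r|//|]; rewrite ?ltry//.
by rewrite gt0_muley// lte_fin expR_gt0.
Qed.

(** An atom makes the transform positive and the hypothesis makes it finite, so neither [lne] nor
    [fine] falls back on a default value. *)
Lemma laplaceE theta a : atoms mu a -> (laplace mu theta < +oo)%E ->
  laplace mu theta = (expR (fine (logpart mu theta)))%:E.
Proof.
move=> mua Loo; have := laplace_gt0 theta mua; rewrite /logpart.
case: (laplace mu theta) Loo => [r _|//|//]; rewrite lte_fin => r0.
by rewrite lne_EFin//= lnK.
Qed.

Lemma distr_setT theta a : atoms mu a -> (laplace mu theta < +oo)%E ->
  distr mu theta setT = 1%E.
Proof.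
move=> mua Loo; rewrite /distr /density.
under eq_integral do rewrite addrC expRD EFinM.
rewrite ge0_integralZl//; last exact: measurable_expR_dot.
rewrite -/(laplace mu theta) (laplaceE mua Loo) -EFinM -expRD.
by rewrite addNr expR0.
Qed.

Lemma distr_set1 theta a :
  distr mu theta [set a] = ((density mu theta a)%:E * mu [set a])%E.
Proof. by rewrite /distr integral_set1_cst//; exact: measurable_set1_borelRk. Qed.

(** On [F], which carries all the mass, the shift multiplies the integrand by the constant
    [expR c]. *)
Lemma laplace_translate F theta zeta c : measurable (F : set (borelRk R k)) ->
  mu (~` F) = 0%E -> (forall x, F x -> dot x zeta = c) ->
  laplace mu (theta + zeta) = ((expR c)%:E * laplace mu theta)%E.
Proof.
move=> mF F0 Fc; rewrite /laplace -ge0_integralZl//; last exact: measurable_expR_dot.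
apply: ae_eq_integral => //.
- exact: measurable_expR_dot.
- by apply: emeasurable_funM => //; exact: measurable_expR_dot.
- apply: (ae_eq_of_null _ mF F0) => x Fx.
  by rewrite -EFinM -expRD dotDr (Fc _ Fx) addrC.
Qed.

Lemma same_distr_density F theta1 theta2 : measurable (F : set (borelRk R k)) ->
  mu (~` F) = 0%E ->
  (forall x, F x -> density mu theta1 x = density mu theta2 x) ->
  same_distr mu theta1 theta2.
Proof.
move=> mF F0 Fd A mA; apply: ae_eq_integral => //.
- by apply/measurable_EFinP; apply: measurable_funTS; exact: measurable_density.
- by apply/measurable_EFinP; apply: measurable_funTS; exact: measurable_density.
- by apply: (ae_eq_of_null _ mF F0) => x Fx; rewrite Fd.
Qed.

(** Comparing masses at an atom and cancelling its finite positive mass equates the densities there;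
    taking logarithms, [theta1 - theta2] has the same value at every point of [S]. Conversely, a
    constant difference is absorbed by the normalization. *)
Lemma same_distrP F S theta1 theta2 : measurable (F : set (borelRk R k)) ->
  mu (~` F) = 0%E -> F !=set0 -> F = convhull S -> S `<=` atoms mu ->
  (laplace mu theta1 < +oo)%E -> (laplace mu theta2 < +oo)%E ->
  same_distr mu theta1 theta2 <-> constant_on F (theta1 - theta2).
Proof.
move=> mF QF [x0 Fx0] FS Smu L1 L2.
have [a Sa] : S !=set0 by apply: (convhull_nonempty (x := x0)); rewrite -FS.
split=> [sd|cst].
  pose c := fine (logpart mu theta1) - fine (logpart mu theta2).
  suff Sc x : S x -> dot (theta1 - theta2) x = c.
    by rewrite FS; apply: (@constant_on_convhull _ _ _ _ a) => // x /Sc ->; rewrite Sc.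
  move=> Sx; have := sd [set x] (measurable_set1_borelRk x).
  have mux0 : (0 < mu [set x])%E by exact: Smu.
  have mule_inj (u v : R) (r : \bar R) : (0 < r)%E -> r \is a fin_num ->
      (u%:E * r = v%:E * r)%E -> u = v.
    by case: r => // r r0 _ [] /(mulIf (lt0r_neq0 r0)).
  rewrite !distr_set1 => /(mule_inj _ _ _ mux0 (atom_fin_num x L1))/expR_inj h.
  rewrite dotC dotBr /c; move: h; move: (fine _) (fine _) => l1 l2; lra.
apply: (same_distr_density mF QF) => x Fx; congr expR.
have Fc y : F y -> dot y (theta1 - theta2) = dot x (theta1 - theta2).
  by move=> Fy; rewrite dotC (cst _ _ Fy Fx) dotC.
(* The constant value of [theta1 - theta2] on [F] is thus the difference of the log-partition
   functions, so the exponents agree. *)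
have := laplace_translate theta2 mF QF Fc.
rewrite [theta2 + _]addrC subrK (laplaceE (Smu _ Sa) L1) (laplaceE (Smu _ Sa) L2).
by rewrite -EFinM -expRD => -[/expR_inj ->]; rewrite dotBr; lra.
Qed.

(* Near an interior parameter, [x_i^2] is dominated by the sum of the two
   exponentials [e^(+- e x_i)], both integrable. *)
Lemma integrable_sqr_coord theta (e : R) (i : 'I_k) : 0 < e ->
  (laplace mu (theta + e *: delta_mx 0 i)%R < +oo)%E ->
  (laplace mu (theta - e *: delta_mx 0 i)%R < +oo)%E ->
  (mdensity mu (density_ge0 theta) (measurable_density theta)).-integrable
    setT (fun x => (Defs.coord i x ^+ 2)%:E).
Proof.
move=> e0 Lp Lm.
have mc2 : measurable_fun setT (fun x : borelRk R k => (Defs.coord i x ^+ 2)%:E).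
  by apply/measurable_EFinP; apply: measurable_funX; exact: measurable_coord.
apply/integrableP; split => //.
under eq_integral do rewrite gee0_abs ?lee_fin ?sqr_ge0//.
rewrite ge0_integral_mdensity//; last by move=> x; rewrite lee_fin sqr_ge0.
(* The factor [4 / e^2] comes from [y^2 <= 4 (expR y + expR (- y))] at [y = e x_i]; the other factor
   normalizes the density. *)
pose K := 4 / e ^+ 2 * expR (- fine (logpart mu theta)).
have K0 : 0 <= K by rewrite mulr_ge0 ?expR_ge0// divr_ge0// sqr_ge0.
pose g (x : borelRk R k) := (K%:E * ((expR (dot x (theta + e *: delta_mx 0 i)%R))%:E +
  (expR (dot x (theta - e *: delta_mx 0 i)%R))%:E))%E.
have mg : measurable_fun setT g.
  by apply: emeasurable_funM => //; apply: emeasurable_funD; exact: measurable_expR_dot.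
apply: (@le_lt_trans _ _ (\int[mu]_x g x)%E).
  apply: ge0_le_integral => //.
  - by move=> x _; rewrite -EFinM lee_fin mulr_ge0 ?sqr_ge0 ?expR_ge0.
  - apply: emeasurable_funM => //; apply/measurable_EFinP.
    exact: measurable_density.
  move=> x _; rewrite /g -EFinD -!EFinM lee_fin /density /K !dotDr -scalerN.
  rewrite scalerN -scaleNr !dotZr dot_delta !expRD.
  rewrite -/(Defs.coord i x); set t := Defs.coord i x.
  have bound (y : R) : y ^+ 2 <= 4 * (expR y + expR (- y)).
    have sq (z : R) : 0 <= z -> z ^+ 2 <= 4 * expR z.
      (* Squaring [1 + z / 2 <= expR (z / 2)] gives [z^2 / 4 <= expR z]. *)
      move=> z0; have := expR_ge1Dx (z / 2).
      have -> : expR z = expR (z / 2) ^+ 2 by rewrite expr2 -expRD; congr expR; lra.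
      by nra.
    have := expR_ge0 y; have := expR_ge0 (- y).
    have [y0|y0] := leP 0 y; first by have := sq _ y0; lra.
    have : 0 <= - y by lra.
    by move=> /sq; rewrite sqrrN; lra.
  have tb : t ^+ 2 <= 4 / e ^+ 2 * (expR (e * t) + expR (- e * t)).
    rewrite mulrAC ler_pdivlMr ?exprn_gt0// mulrC -exprMn mulNr.
    exact: bound.
  have := ler_wpM2r (mulr_ge0 (expR_ge0 (dot x theta))
    (expR_ge0 (- fine (logpart mu theta)))) tb.
  by move/le_trans; apply; rewrite le_eqVlt; apply/orP; left; apply/eqP; ring.
rewrite /g ge0_integralZl//; last 2 first.
- by apply: emeasurable_funD; exact: measurable_expR_dot.
- by move=> x _; rewrite adde_ge0.
rewrite ge0_integralD//; [|exact: measurable_expR_dot|exact: measurable_expR_dot].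
apply: lte_mul_pinfty; [by rewrite lee_fin|by []|].
by apply: lte_add_pinfty; [exact: Lp|exact: Lm].
Qed.

Lemma fisher_cov_mx theta : fisher mu theta =
  cov_mx (mdensity mu (density_ge0 theta) (measurable_density theta)).
Proof. by []. Qed.

(** Finiteness of the transform on both sides of [theta] along each axis supplies the second moments
    required for the covariance kernel. *)
Lemma has_dim_rank_fisher F S theta :
  measurable (F : set (borelRk R k)) -> mu (~` F) = 0%E -> F !=set0 ->
  F = convhull S -> S `<=` atoms mu ->
  (laplace mu theta < +oo)%E ->
  (forall i, exists2 e : R, 0 < e &
     (laplace mu (theta + e *: delta_mx 0 i)%R < +oo)%E /\
     (laplace mu (theta - e *: delta_mx 0 i)%R < +oo)%E) ->
  has_dim F (\rank (fisher mu theta)).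
Proof.
move=> mF QF F0 FS Smu Lt Lnear; rewrite fisher_cov_mx.
apply: has_dim_rank => // c; apply: (@cov_mx_mul_eq0 _ _ _ F S) => //.
- have [x0] := F0; rewrite FS => /convhull_nonempty[a Sa].
  exact: (distr_setT (Smu _ Sa)).
- rewrite /= /mdensity null_set_integral//.
  + exact: measurableC.
  + by apply/measurable_EFinP; apply: measurable_funTS; exact: measurable_density.
- move=> x Sx; rewrite -[X in (0 < X)%E]/(distr mu theta [set x]) distr_set1.
  by rewrite mule_gt0 ?Smu// lte_fin expR_gt0.
- by move=> i; have [e e0 [Lp Lm]] := Lnear i; exact: (integrable_sqr_coord e0 Lp Lm).
Qed.

End exponential_family.

(** * Identifiability and Fisher rank on a proper face *)

Theorem lemma2p2 (R : realType) (k : nat)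
    (nu : {measure set (borelRk R k) -> \bar R})
    (Theta : set 'rV[R]_k) (F : set 'rV[R]_k)
    (nu_concentrated : nu (~` supp nu) = 0%E)
    (Theta_neq0 : Theta !=set0)
    (Theta_natural : forall theta, Theta theta -> (laplace nu theta < +oo)%E)
    (A1 : countable (supp nu))
    (A2 : polyhedron (convex_support nu) /\ has_dim (convex_support nu) k)
    (A3 : forall G : set 'rV[R]_k, is_face (convex_support nu) G ->
       exists S : set 'rV[R]_k, S `<=` atoms nu /\ G = convhull S)
    (A4 : open Theta)
    (F_proper : proper_face (convex_support nu) F) :
  [/\ nonidentifiable (restriction nu F) Theta,
      (forall theta1 theta2, Theta theta1 -> Theta theta2 ->
         same_distr (restriction nu F) theta1 theta2 <->
         lin (normal_cone (convex_support nu) F) (theta1 - theta2))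
    & forall theta zeta, Theta theta ->
         lin (normal_cone (convex_support nu) F) zeta ->
         (logpart (restriction nu F) (theta + zeta) < +oo)%E /\
         has_dim F (\rank (fisher (restriction nu F) (theta + zeta)))].
Proof.
set P := convex_support nu in A2 A3 F_proper *.
have [Fface FP] := F_proper; have [[x0 Fx0] [c0 Fc0]] := Fface.
have mF : measurable (F : set (borelRk R k)).
  by apply: measurable_face Fface; exact: closed_closure.
have [S [Snu FS]] := A3 _ Fface.
pose nuF : {measure set (borelRk R k) -> \bar R} := mrestr nu mF.
have -> : restriction nu F = nuF :> (set (borelRk R k) -> \bar R) by [].
have nuF0 : nuF (~` F) = 0%E by rewrite /nuF /= /mrestr setICl measure0.
have SF x : S x -> F x.
  by move=> Sx; rewrite FS; exact: sub_convhull.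
have SnuF : S `<=` atoms nuF.
  move=> x Sx; rewrite /atoms /= /mrestr (_ : [set x] `&` F = [set x]).
    exact: Snu.
  by apply/seteqP; split=> [y []//|y ->]; split => //; exact: SF.
have [a Sa] : S !=set0 by apply: (convhull_nonempty (x := x0)); rewrite -FS.
have LF theta : Theta theta -> (laplace nuF theta < +oo)%E.
  move=> /Theta_natural; apply: le_lt_trans.
  by apply: ge0_integral_mrestr_le => //; exact: measurable_expR_dot.
have linP u : lin (normal_cone P F) u <-> constant_on F u.
  split; first exact: lin_normal_cone_constant.
  exact: constant_lin_normal_cone A2.1 Fface.
have sdP theta1 theta2 : Theta theta1 -> Theta theta2 ->
    same_distr nuF theta1 theta2 <-> lin (normal_cone P F) (theta1 - theta2).
  move=> T1 T2; rewrite linP; apply: (same_distrP mF nuF0 _ FS SnuF).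
  - by exists x0.
  - exact: LF.
  - exact: LF.
split => //.
(* The zero functional would expose all of [P], contradicting properness. *)
- have c00 : c0 <> 0.
    move=> c00; apply: FP; rewrite Fc0 c00; apply/seteqP; split=> [x []//|x Px].
    by split => // y _; rewrite !dot0l.
  have [theta Tt] := Theta_neq0.
  have [e e0 Te] := open_line c0 A4 Tt.
  have Te' : Theta (theta + e *: c0) by apply: Te; rewrite gtr0_norm.
  exists (theta + e *: c0), theta; split; [exact: Te'|exact: Tt| |].
    rewrite -[RHS]addr0 => /addrI/eqP.
    by rewrite scaler_eq0 gt_eqF//= => /eqP.
  apply/(sdP _ _ Te' Tt); rewrite addrC addKr; apply/linP => x y.
  rewrite Fc0 => -[Px Mx] [Py My]; rewrite !dotZl; congr (_ * _).
  by apply/eqP; rewrite eq_le My// Mx.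
- move=> theta zeta Tt /linP zF.
  (* The point [t + zeta] may leave [Theta], but [zeta] is constant on [F], so the transform only
     changes by a finite factor. *)
  have Lz t : Theta t -> (laplace nuF (t + zeta) < +oo)%E.
    move=> Tt'; rewrite (@laplace_translate _ _ _ F _ _ (dot x0 zeta)) //.
      by rewrite lte_mul_pinfty// ?lee_fin ?expR_ge0// LF.
    by move=> x Fx; rewrite dotC (zF _ _ Fx Fx0) dotC.
  split.
    by rewrite /logpart (laplaceE (SnuF _ Sa) (Lz _ Tt)) lne_EFin ?expR_gt0// ltry.
  apply: (has_dim_rank_fisher mF nuF0 _ FS SnuF (Lz _ Tt)); first by exists x0.
  move=> i; have [e e0 Te] := open_line (delta_mx 0 i) A4 Tt.
  (* Swapping the summands writes the perturbed parameter as a point of [Theta] plus [zeta], to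
     which [Lz] applies. *)
  exists e => //; rewrite -scaleNr !(addrAC theta zeta).
  by split; apply/Lz/Te; rewrite ?normrN gtr0_norm.
Qed.
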